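(* Let $t$ be a positive integer. Every $t$-coloring of the edges of the ordered complete graph on $[t+3]$ contains a monochromatic non-nested matching of size $2$; that is, there exist two independent edges of the same color that are not nested.
   Context: The ordered complete graph on $[m]=\{1,\dots,m\}$ is the complete graph with vertex set $[m]$, taken with its natural ordering; edges are written $(i,j)$ with $i<j$. A $t$-coloring assigns one of $t$ colors to each edge. Two edges are independent if they share no vertex; independent edges $(a,b)$ and $(c,d)$ are nested if $a<c<d<b$ or $c<a<b<d$. A matching is a set of pairwise independent edges; it is non-nested if no two of its edges are nested, and monochromatic if all its edges have the same color. *)

(* Defs.v *)
From mathcomp Require Import all_boot.

Set Implicit Arguments.
Unset Strict Implicit.
Unset Printing Implicit Defensive.

(* The vertex set {1, ..., m} is rendered as 'I_m = {0, ..., m - 1}; only its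
   order matters. *)
Definition edge (m : nat) : Type := {e : 'I_m * 'I_m | e.1 < e.2}.

Definition left_end (m : nat) (e : edge m) : 'I_m := (val e).1.
Definition right_end (m : nat) (e : edge m) : 'I_m := (val e).2.

Definition endpoints (m : nat) (e : edge m) : {set 'I_m} :=
  [set left_end e; right_end e].

Definition coloring (t m : nat) : Type := edge m -> 'I_t.

Definition independent (m : nat) (e f : edge m) : bool :=
  [disjoint endpoints e & endpoints f].

(* Either chain of inequalities forces the two edges to be independent. *)
Definition nested (m : nat) (e f : edge m) : bool :=
  [&& left_end e < left_end f, left_end f < right_end f
    & right_end f < right_end e]
  || [&& left_end f < left_end e, left_end e < right_end e
       & right_end e < right_end f].

Definition matching (m : nat) (M : {set edge m}) : Prop :=
  forall e f : edge m, e \in M -> f \in M -> e != f -> independent e f.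

Definition non_nested (m : nat) (M : {set edge m}) : Prop :=
  forall e f : edge m, e \in M -> f \in M -> ~~ nested e f.

Definition monochromatic (t m : nat) (c : coloring t m) (M : {set edge m}) :
  Prop :=
  forall e f : edge m, e \in M -> f \in M -> c e = c f.

(* Main.v *)
Require Import Defs.
From mathcomp Require Import all_boot zify.

(** The graph on the edges of the ordered K_(t+3), in which two edges are joined
    when they are independent and not nested, needs more than t colours even
    after the edge 01 is deleted; this stronger form goes through induction on t.
    Let k be the colour of 02 and let d be the largest vertex with 2d of colour k
    (d = 0 if there is none).
    Any edge avoiding the vertices 0, 1, 2 and any edge 1b with b > 2 conflicts
    with 02; any edge 0b with 2 < b < d conflicts with 2d; and no edge 2b with
    b > d has colour k.  Replace 0, 1, 2 by two vertices x < y, giving xb the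
    colour of 0b if b < d and of 1b otherwise, and yb the colour of 1b if b <= d
    and of 2b otherwise.  The new edge xy plays the role of 01, conflicting new
    edges come from conflicting old ones, and the colour k has disappeared. *)

Set Implicit Arguments.
Unset Strict Implicit.
Unset Printing Implicit Defensive.

(** Here [i] is numbered after the merging and [j] before it, hence the calls with [j.+1]. At
    [j = d] both 0j and 2j may have colour k, so x and y must both fall back on 1j: this forces
    [d <= j] for one and [d < j] for the other. *)
Definition merged_end (d i j : nat) : nat :=
  if i is i'.+1 then if i' is 0 then 1 + (d < j) else i.+1 else d <= j.

Lemma last_edge_of_color (T : eqType) (m : nat) (f : nat -> nat -> T) (k : T) :
  (forall a b c d, a < c -> c < b -> b < d -> d < m -> f a b != f c d) ->
  exists d, (forall b, 2 < b -> d < b -> b < m -> f 2 b != k) /\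
            (forall b, 2 < b -> b < d -> f 0 b != k).
Proof.
move=> crossP.
have [/existsP[d0 Pd0]|/existsPn noP] :=
  boolP [exists d : 'I_m, (2 < d) && (f 2 d == k)].
- case: (@arg_maxnP _ d0 (fun d : 'I_m => (2 < d) && (f 2 d == k)) val Pd0) =>
    d /andP[d2 /eqP fd] dmax.
  exists d; split=> b b2 bd.
    move=> bm; apply/negP=> /eqP fb.
    have := dmax (Ordinal bm); rewrite /= b2 fb eqxx => /(_ isT); lia.
  by rewrite -fd; apply: crossP => //; lia.
- exists 0; split=> [b b2 _ bm|b]; last by lia.
  by have := noP (Ordinal bm); rewrite /= b2.
Qed.

(** Colours lie in a set [S] so that the induction can discard k. For [i < j], the bound [1 < j]
    excludes exactly the edge 01. *)
Lemma proper_coloring_card (T : finType) (t : nat) (S : {set T})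
    (f : nat -> nat -> T) :
  (forall i j, i < j -> j < t + 3 -> 1 < j -> f i j \in S) ->
  (forall a b c d, a < b -> c < d -> a < c -> b < d -> b != c -> d < t + 3 ->
     1 < b -> f a b != f c d) ->
  t < #|S|.
Proof.
elim: t S f => [|t IHt] S f fS fP.
  by apply/card_gt0P; exists (f 0 2); apply: fS.
pose k := f 0 2.
have kS : k \in S by apply: fS => //; lia.
have [a b c d ac cb bd dm|d [f2k f0k]] :=
  @last_edge_of_color _ (t.+1 + 3) f k.
  by apply: fP; lia.
rewrite (cardsD1 k S) kS add1n ltnS.
apply: (IHt _ (fun i j => f (merged_end d i j.+1) j.+1)) => [i j ij jm j1|].
- rewrite !inE fS ?andbT; [| | lia | lia]; last first.
    by case: i ij => [|[|i]] /= ?; lia.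
  case: i ij => [|[|i]] ij /=.
  + case: (leqP d j.+1) => dj /=; last by apply: f0k; lia.
    by rewrite eq_sym; apply: fP; lia.
  + case: (ltnP d j.+1) => dj /=; first by apply: f2k; lia.
    by rewrite eq_sym; apply: fP; lia.
  + by rewrite eq_sym; apply: fP; lia.
- move=> a b c e ab ce ac be bc em b1.
  apply: fP; try lia.
  + by case: a ab ac => [|[|a]] /= ? ?; lia.
  + by case: c ce ac bc => [|[|c]] /= ? ? ?; lia.
  (* The tight case is x against y: if x stands for 1, then [d <= b.+1 < e.+1], so y stands for
     2. *)
  + by case: a ab ac => [|[|a]] _ ac; case: c ce ac bc => [|[|c]] /= *; lia.
  + by case: c ce ac bc => [|[|c]] /= ? ? ?; lia.
Qed.

Lemma independentE (m : nat) (e f : edge m) :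
  independent e f =
  [&& left_end e != left_end f, left_end e != right_end f,
      right_end e != left_end f & right_end e != right_end f].
Proof.
rewrite /independent /endpoints disjoints_subset subUset !sub1set !inE.
by rewrite !negb_or -!andbA.
Qed.

Lemma independentC (m : nat) (e f : edge m) :
  independent e f = independent f e.
Proof. by rewrite /independent disjoint_sym. Qed.

Lemma nestedC (m : nat) (e f : edge m) : nested e f = nested f e.
Proof. by rewrite /nested orbC. Qed.

Lemma nestedxx (m : nat) (e : edge m) : nested e e = false.
Proof. by rewrite /nested ltnn. Qed.

Lemma pair_matching (t m : nat) (c : coloring t m) (e f : edge m) :
  independent e f -> ~~ nested e f -> c e = c f ->
  exists M : {set edge m},
    [/\ matching M, non_nested M, monochromatic c M & #|M| = 2].
Proof.
move=> ief nef cef; exists [set e; f]; split.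
- move=> g h; rewrite !inE => /orP[] /eqP-> /orP[] /eqP->; rewrite ?eqxx //.
  by rewrite independentC.
- move=> g h; rewrite !inE => /orP[] /eqP-> /orP[] /eqP->;
    by rewrite ?nestedxx // nestedC.
- by move=> g h; rewrite !inE => /orP[] /eqP-> /orP[] /eqP->.
- rewrite cards2; case: eqP => // ef.
  by move: ief; rewrite independentE ef eqxx.
Qed.

Theorem theorem2p11 (t : nat) (ht : 0 < t) (c : coloring t (t + 3)) :
  exists M : {set edge (t + 3)},
    [/\ matching M, non_nested M, monochromatic c M & #|M| = 2].
Proof.
have [/existsP[e /existsP[f /and3P[ief nef /eqP cef]]]|/existsPn noP] :=
  boolP [exists e : edge (t + 3), exists f : edge (t + 3),
           [&& independent e f, ~~ nested e f & c e == c f]].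
  exact: pair_matching ief nef cef.
have lt0m : 0 < t + 3 by lia.
pose pt i : 'I_(t + 3) := insubd (Ordinal lt0m) i.
have ptE i : i < t + 3 -> pt i = i :> nat.
  by move=> im; rewrite /pt val_insubd im.
(* Non-increasing pairs get colour 0 as a default; [colE] covers all the pairs that matter. *)
pose col i j := oapp c (Ordinal ht) (insub (pt i, pt j) : option (edge (t + 3))).
have colE i j : i < j -> j < t + 3 ->
    exists e : edge (t + 3),
      [/\ col i j = c e, left_end e = i :> nat & right_end e = j :> nat].
  move=> ij jm; have im := ltn_trans ij jm.
  rewrite /col; case: insubP => [e _ eE|]; last by rewrite /= !ptE // ij.
  by exists e; rewrite /left_end /right_end eE /= !ptE.
suff: t < #|[set: 'I_t]| by rewrite cardsT card_ord ltnn.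
apply: (@proper_coloring_card _ t _ col) => [i j _ _ _|]; first by rewrite inE.
move=> a b a' b' ab ab' aa' bb' ba' b'm _.
have [e [-> le re]] := colE a b ab (ltn_trans bb' b'm).
have [f [-> lf rf]] := colE a' b' ab' b'm.
have /existsPn/(_ f) := noP e.
have -> : independent e f.
  by rewrite independentE -!val_eqE /= le re lf rf; lia.
have -> : ~~ nested e f by rewrite /nested le re lf rf; lia.
by [].
Qed.
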